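(* Let $\beta_1\in(1,\frac{1+\sqrt5}{2})$. Then there exists $c=c(\beta_1)>0$ such that for all $\beta_2,\beta_3\in(1,1+c)$ and all $x\in(-\frac{1}{\beta_1-1},\frac{1}{\beta_1-1})$ the fibre $\Lambda^{x}_{\beta_1,\beta_2,\beta_3}$ contains an interval. Moreover, (for all such $\beta_2,\beta_3$) $\Lambda_{\beta_1,\beta_2,\beta_3}$ has non-empty interior and $(0,0)$ belongs to the interior of $\Lambda_{\beta_1,\beta_2,\beta_3}$.
   Context: For $1<\beta_1,\beta_2,\beta_3\le2$ let $S_{-1},S_1:\mathbb{R}^2\to\mathbb{R}^2$ be $$S_{-1}(x,y)=\Big(\frac{x-1}{\beta_1},\frac{y-1}{\beta_2}\Big),\qquad S_1(x,y)=\Big(\frac{x+1}{\beta_1},\frac{y+1}{\beta_3}\Big).$$ $\Lambda_{\beta_1,\beta_2,\beta_3}$ denotes the attractor of $\{S_{-1},S_1\}$, i.e. the unique non-empty compact set $\Lambda\subseteq\mathbb{R}^2$ with $\Lambda=S_{-1}(\Lambda)\cup S_1(\Lambda)$. Its projection to the $x$-axis is $[\frac{-1}{\beta_1-1},\frac1{\beta_1-1}]$. For $x$ in this projection, the fibre of $x$ is $\Lambda^{x}_{\beta_1,\beta_2,\beta_3}:=\{y\in\mathbb{R}:(x,y)\in\Lambda_{\beta_1,\beta_2,\beta_3}\}$. ''Interval'' means a nontrivial (non-degenerate) interval. *)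

(* Defs.v *)
From HB Require Import structures.
From mathcomp Require Import all_boot all_order all_algebra.
From mathcomp Require Import all_classical all_reals all_analysis.
Set Implicit Arguments.
Unset Strict Implicit.
Unset Printing Implicit Defensive.
Import Order.TTheory GRing.Theory Num.Theory.
Import numFieldNormedType.Exports.
Local Open Scope classical_set_scope.
Local Open Scope ring_scope.

(* [Sm] and [Sp] are the maps S_{-1} and S_1. *)
Definition Sm {R : realType} (b1 b2 : R) (p : R * R) : R * R :=
  ((p.1 - 1) / b1, (p.2 - 1) / b2).

Definition Sp {R : realType} (b1 b3 : R) (p : R * R) : R * R :=
  ((p.1 + 1) / b1, (p.2 + 1) / b3).

Definition is_attractor {R : realType} (b1 b2 b3 : R) (L : set (R * R)) : Prop :=
  [/\ L !=set0, compact L & L = Sm b1 b2 @` L `|` Sp b1 b3 @` L].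

(* For [b1, b2, b3 > 1] both maps are contractions, so exactly one set satisfies
   [is_attractor] (Hutchinson) and the default value [set0] is irrelevant. *)
Definition attractor {R : realType} (b1 b2 b3 : R) : set (R * R) :=
  xget set0 (is_attractor b1 b2 b3).

Definition fibre {R : realType} (b1 b2 b3 x : R) : set R :=
  xsection (attractor b1 b2 b3) x.

(* [is_interval] also holds of the empty set and of singletons, hence the second
   conjunct. *)
Definition nondegenerate_interval {R : realType} (I : set R) : Prop :=
  is_interval I /\ exists a b : R, [/\ I a, I b & a < b].

(* Main.v *)
Require Import Defs.
From HB Require Import structures.
From mathcomp Require Import all_boot all_order all_algebra.
From mathcomp Require Import all_classical all_reals all_analysis.
From mathcomp Require Import ring lra.
Import Order.TTheory GRing.Theory Num.Theory.
Import numFieldNormedType.Exports.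
Local Open Scope classical_set_scope.
Local Open Scope ring_scope.

(** Inverting the contractions turns the question into a control problem.  A bounded
    set [A] with [A] included in [Sm A] union [Sp A] lies in the attractor
    ([backward_invariant_sub_attractor]): this inclusion says that from every point
    of [A] one of the two expanding moves [(x, y) |-> (b1 x - d, b y - d)], with
    [d = 1] and [b = b3] or [d = -1] and [b = b2], leads back into [A].  So it is
    enough to steer both coordinates with one sequence of digits [d] so that they
    stay bounded.

    When [b2] and [b3] are close to 1, the second coordinate is roughly [y] minus the
    sum of the digits used so far.  It stays bounded if, wherever [x] is, one can keep
    [x] bounded and still make the digit sum drift upwards; by the symmetry
    [x |-> - x] one can then make it drift downwards as well, and the sign of [y]
    decides which of the two to do.  The golden ratio is what makes the upward drift
    possible.  The expanding maps in [x] have the orbit of period two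
    [1/(b1+1), -1/(b1+1)], which uses the digits 1 and -1 alternately, and for [b1]
    below the golden ratio this orbit lies strictly inside the region where both
    digits are admissible.  Use the digit 1 from a threshold slightly to the right of
    [1/(b1+1)] on, and -1 before it.  A digit 1 then lands to the right of
    [-1/(b1+1)], hence after at most one digit -1 the point is beyond the threshold
    again; alternation pushes the point away from the unstable periodic orbit, to the
    right, until two digits 1 occur in a row.  [drift_potential] expresses this drift
    by a bounded function [phi] of [x] with [phi x' - d <= phi x - delta] along each
    move.  Since [y + phi x] is then nonincreasing for [y >= 0] and [b2], [b3] close
    enough to 1, a sublevel set of it, together with its mirror image, is
    the set [A] ([box_in_backward_invariant]).

    The set [A] contains a box around the origin, which gives the claim on the
    interior and that on the fibres over the projection [[-r, r]] of the box, where [r]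
    depends on [b1] only.  For the remaining [x], expanding moves bring
    [x] into this interval, and pulling back a vertical segment along them gives a
    segment in the fibre of [x] ([fibre_segment_spread]). *)

(** * Upward drift of the digits *)

Lemma golden_ratio_bound (R : rcfType) (b : R) :
  1 < b -> b < (1 + Num.sqrt 5) / 2 -> b * b < b + 1.
Proof.
move=> b1 bg.
have s5 : Num.sqrt 5 * Num.sqrt 5 = 5 :> R by rewrite -expr2 sqr_sqrtr.
have h : 2 * b - 1 < Num.sqrt 5 by lra.
have h2 : 0 < (Num.sqrt 5 - (2 * b - 1)) * (Num.sqrt 5 + (2 * b - 1)).
  by apply: mulr_gt0; lra.
rewrite !(mulrDl, mulrDr, mulrBl, mulrBr) in h2; lra.
Qed.

(** For [b] below the golden ratio, the orbit of period two of the expanding maps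
    [x |-> b x - 1] and [x |-> b x + 1], namely [x1, -x1] with [x1 = 1/(b+1)], lies
    strictly inside the switch region, where both maps keep the point in
    [[-1/(b-1), 1/(b-1)]].  The number [eps] is the room left around that orbit: even from
    the threshold [x1 + eps] the digit -1 leads strictly inside the interval. *)
Lemma period_two_slack (R : realFieldType) (b : R) : 1 < b -> b * b < b + 1 ->
  exists x1 eps : R, [/\ (b + 1) * x1 = 1, 0 < eps, (b - 1) * eps < x1 &
    (b - 1) * (b * (x1 + eps) + 1) < 1].
Proof.
move=> b1 bg.
pose x1 := (b + 1)^-1.
have x1E : (b + 1) * x1 = 1 by rewrite divff//; lra.
have x1_gt0 : 0 < x1 by rewrite invr_gt0; lra.
pose g := 1 - (b - 1) * (b * x1 + 1).
have gE : g = 2 * x1 * (1 + b - b * b).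
  have -> : g = (b + 1) * x1 * (1 - (b - 1)) - (b - 1) * (b * x1).
    by rewrite x1E /g; ring.
  by ring.
have g_gt0 : 0 < g by rewrite gE !mulr_gt0//; lra.
have bb_gt0 : 0 < b * (b - 1) by apply: mulr_gt0; lra.
(* Half of the room [g] left by the periodic orbit itself. *)
pose eps := g / (2 * (b * (b - 1))).
have epsE : b * (b - 1) * eps = g / 2.
  by rewrite /eps; field; apply/andP; split; lra.
exists x1, eps; split=> //.
- by rewrite divr_gt0//; lra.
- have h : 0 < x1 * (b * b - 1) by apply: mulr_gt0 => //; nra.
  have : b * ((b - 1) * eps) < b * x1 by rewrite mulrA epsE gE; lra.
  by rewrite ltr_pM2l//; lra.
- have -> : (b - 1) * (b * (x1 + eps) + 1) = 1 - (g - b * (b - 1) * eps).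
    by rewrite /g; ring.
  by rewrite epsE; lra.
Qed.

(** The linear part of [phi] balances the digits exactly on the orbit of period two
    [x1, -x1].  It gains by a fixed amount when the digit 1 is used beyond some point
    to the right of [x1], and the digit -1 beyond some point to the right of [-x1].  A
    threshold [t > x1] ensures the former, and after a digit 1 also the latter.
    Further to the left several digits -1 in a row may be unavoidable; they are paid
    for by the second, steep part, which vanishes on all points reached by a digit 1. *)
Lemma drift_potential (R : realFieldType) (b : R) : 1 < b -> b * b < b + 1 ->
  exists (r delta F : R) (phi : R -> R),
    [/\ 1 <= r, (b - 1) * r < 1, 0 < delta,
        forall x, `|x| <= r -> `|phi x| <= F &
        forall x, `|x| <= r -> exists d, [/\ d = 1 \/ d = - 1,
          `|b * x - d| <= r & phi (b * x - d) - d <= phi x - delta]].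
Proof.
move=> b1 bg.
have [x1 [eps [x1E eps_gt0 eps_small slack]]] := period_two_slack _ _ b1 bg.
have b1eps : 0 < (b - 1) * eps by apply: mulr_gt0; lra.
pose t := x1 + eps.
pose r := b * t + 1.
(* The digit 1 is used from [t] on, so its images lie above [m]. *)
pose m := b * t - 1.
(* With this slope, [- a x] exactly balances the digits along the orbit of period
   two. *)
pose a := (b + 1) / 2.
have [rdef mdef] : r = b * t + 1 /\ m = b * t - 1 by [].
pose delta := (b * b - 1) * eps / 4.
have a_gt0 : 0 < a by rewrite /a; lra.
have aE : a * ((b - 1) * x1) = (b - 1) / 2.
  have -> : a * ((b - 1) * x1) = ((b + 1) * x1) * (b - 1) / 2 by rewrite /a; ring.
  by rewrite x1E; ring.
have delta_gt0 : 0 < delta.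
  have h : 0 < (b + 1) * ((b - 1) * eps) by apply: mulr_gt0; lra.
  by rewrite /delta; lra.
have adelta : a * ((b - 1) * eps) = 2 * delta by rewrite /a /delta; field.
have gain_left : a * ((b - 1) * (- x1 + eps / 2) + 1) = 1 + delta.
  have -> : a * ((b - 1) * (- x1 + eps / 2) + 1) =
    a + a * ((b - 1) * eps) / 2 - a * ((b - 1) * x1) by ring.
  by rewrite aE adelta /a; field.
have gain_right : a * (1 - (b - 1) * t) = 1 - 2 * delta.
  have -> : a * (1 - (b - 1) * t) =
    a - a * ((b - 1) * x1) - a * ((b - 1) * eps) by rewrite /t; ring.
  by rewrite aE adelta /a; field.
clear aE adelta.
pose kappa := 1 - (b - 1) * r.
have kappa_gt0 : 0 < kappa by rewrite subr_gt0.
have kdef : kappa = 1 - (b - 1) * r by [].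
have bt_gt0 : 0 < b * t by apply: mulr_gt0; rewrite ?/t; lra.
have r_ge1 : 1 <= r by rewrite /r; lra.
have beps : eps < b * eps by rewrite ltr_pMl.
have mx1 : m = - x1 + b * eps.
  rewrite /m /t mulrDr; lra.
have mt : m <= t by rewrite mx1 /t; lra.
clear slack x1E eps_small b1eps.
(* A point left of [- x1 + eps / 2] moves right by at least [kappa], and lies at least
   [b * eps / 2] to the left of [m]; so [max 0 (m - x)] decreases by at
   least [gap]. *)
pose gap := Num.min kappa (b * eps / 2).
have gap_gt0 : 0 < gap by rewrite lt_min; apply/andP; split; lra.
have [gap1 gap2] : gap <= kappa /\ gap <= b * eps / 2.
  by rewrite /gap !ge_min !lexx orbT.
pose B := (1 + delta) / gap.
have B_gt0 : 0 < B by rewrite divr_gt0//; lra.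
have BE : B * gap = 1 + delta by rewrite /B divfK// gt_eqF.
pose phi x := - (a * x) + B * Num.max 0 (m - x).
exists r, delta, (a * r + B * (`|m| + r)), phi.
split=> //; first by lra.
  move=> x xr; rewrite /phi; apply: (le_trans (ler_normD _ _)).
  rewrite normrN (normrM a) (normrM B).
  rewrite (gtr0_norm a_gt0) (gtr0_norm B_gt0) lerD ?ler_pM2l//.
  have := ler_normB m x; have := normr_ge0 m; have := normr_ge0 x.
  by case: (leP 0 (m - x)) => _; rewrite ?normr0; lra.
move=> x; rewrite ler_norml => /andP[xl xr].
have bx : (b - 1) * x <= (b - 1) * r by rewrite ler_wpM2l//; lra.
have bx' : (b - 1) * - r <= (b - 1) * x by rewrite ler_wpM2l//; lra.
have [xt|tx] := ltP x t.
  exists (- 1).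
  have bxt : b * x <= b * t by rewrite ler_wpM2l//; lra.
  split; [by right | by rewrite ler_norml; apply/andP; split; lra|].
  rewrite opprK /phi.
  have hphi : B * Num.max 0 (m - (b * x + 1)) <= B * Num.max 0 (m - x).
    rewrite ler_pM2l//.
    by case: (leP 0 (m - x)) => ?; case: (leP 0 (m - (b * x + 1))) => ?; lra.
  have [xm|xm] := leP (- x1 + eps / 2) x.
    have : a * ((b - 1) * (- x1 + eps / 2) + 1) <= a * ((b - 1) * x + 1).
      by rewrite ler_pM2l// lerD2r ler_wpM2l//; lra.
    have : a * (b * x + 1) = a * x + a * ((b - 1) * x + 1) by ring.
    lra.
  have : B * Num.max 0 (m - (b * x + 1)) + B * gap <= B * Num.max 0 (m - x).
    rewrite -mulrDr ler_pM2l//.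
    by case: (leP 0 (m - x)) => ?; case: (leP 0 (m - (b * x + 1))) => ?; lra.
  have : a * x <= a * (b * x + 1) by rewrite ler_wpM2l//; lra.
  lra.
exists 1; have bxt : b * t <= b * x by rewrite ler_wpM2l//; lra.
split; [by left | by rewrite ler_norml; apply/andP; split; lra|].
rewrite /phi !max_l; [|lra|lra].
have : a * (1 - (b - 1) * x) <= a * (1 - (b - 1) * t).
  by rewrite ler_pM2l// lerD2l lerN2 ler_wpM2l//; lra.
have : a * (b * x - 1) = a * x - a * (1 - (b - 1) * x) by ring.
lra.
Qed.

(** * Backward invariant sets *)

Definition box {R : realType} (r s : R) : set (R * R) :=
  [set p | `|p.1| <= r /\ `|p.2| <= s].

Definition hutchinson {R : realType} (b1 b2 b3 : R) (A : set (R * R)) :=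
  Sm b1 b2 @` A `|` Sp b1 b3 @` A.

Lemma hutchinsonS (R : realType) (b1 b2 b3 : R) :
  {homo hutchinson b1 b2 b3 : A B / A `<=` B}.
Proof.
by move=> A B AB p [] [q Aq <-]; [left|right]; exists q => //; exact: AB.
Qed.

Lemma in_hutchinson_Sm (R : realType) (b1 b2 b3 : R) A x y : 0 < b1 -> 0 < b2 ->
  A (b1 * x + 1, b2 * y + 1) -> hutchinson b1 b2 b3 A (x, y).
Proof.
move=> b10 b20 Axy; left; exists (b1 * x + 1, b2 * y + 1) => //.
by rewrite /Sm /= !addrK !(mulrC _ x) !(mulrC _ y) !mulfK ?gt_eqF.
Qed.

Lemma in_hutchinson_Sp (R : realType) (b1 b2 b3 : R) A x y : 0 < b1 -> 0 < b3 ->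
  A (b1 * x - 1, b3 * y - 1) -> hutchinson b1 b2 b3 A (x, y).
Proof.
move=> b10 b30 Axy; right; exists (b1 * x - 1, b3 * y - 1) => //.
by rewrite /Sp /= !subrK !(mulrC _ x) !(mulrC _ y) !mulfK ?gt_eqF.
Qed.

(** The set [A] consists of the [(x, y)] with [y >= 0] and [y + phi x <= F + 1], and of
    the mirror images of such points.  A step from the first half either stays there
    or makes [y] negative; then [|y| <= 1], and the bound [F + 1] leaves enough room for
    the point to lie in the second half, whatever the value of [phi]. *)
Lemma box_in_backward_invariant (R : realType) (b1 : R) :
  1 < b1 -> b1 * b1 < b1 + 1 ->
  exists r c : R, [/\ 1 <= r, (b1 - 1) * r < 1, 0 < c &
    forall b2 b3, 1 < b2 < 1 + c -> 1 < b3 < 1 + c ->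
      exists A : set (R * R), [/\ box r 1 `<=` A,
        exists M, A `<=` box M M & A `<=` hutchinson b1 b2 b3 A]].
Proof.
move=> b1_gt1 b1_golden.
have [r [delta [F [phi [r1 b1r delta0 phiF step]]]]] :=
  drift_potential _ _ b1_gt1 b1_golden.
have F0 : 0 <= F.
  by apply: le_trans (phiF 0 _); rewrite ?normr0 ?normr_ge0//; lra.
have phiB x : `|x| <= r -> - F <= phi x <= F by move/phiF; rewrite ler_norml.
(* In the set below [y <= 2 F + 1], so the excess [(b - 1) y] of one step over the
   unexpanded motion of [y] is at most [delta], the gain of [phi]. *)
pose c := delta / (2 * F + 1).
have cE : c * (2 * F + 1) = delta by rewrite /c divfK// gt_eqF//; lra.
have c0 : 0 < c by rewrite divr_gt0//; lra.
pose up : set (R * R) := [set p | 0 <= p.2 /\ p.2 + phi p.1 <= F + 1].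
pose A : set (R * R) :=
  [set p | `|p.1| <= r /\ (up p \/ up (- p.1, - p.2))].
have steer x y : `|x| <= r -> up (x, y) -> exists d, (d = 1 \/ d = - 1) /\
    forall b, 1 < b < 1 + c -> A (b1 * x - d, b * y - d).
  move=> xr [/= y0 yphi]; have [d [d1 xr' phid]] := step x xr.
  exists d; split=> // b /andP[b_gt1 bc]; split=> //=.
  have phix := phiB _ xr.
  have dy : (b - 1) * y <= delta.
    by rewrite -cE; apply: ler_pM => //; lra.
  have [y'0|y'0] := leP 0 (b * y - d); first by left; split => //=; lra.
  right; split=> /=; first by lra.
  have := phiB (- (b1 * x - d)); rewrite normrN => /(_ xr').
  have : 0 <= (b - 1) * y by rewrite mulr_ge0//; lra.
  by case: d1 => ->; lra.
have AN x y : A (x, y) -> A (- x, - y).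
  by case=> /= xr Axy; split; rewrite /= ?normrN// !opprK; case: Axy; [right|left].
exists r, c; split=> // b2 b3 b2c b3c.
have [b10 b20 b30] : [/\ 0 < b1, 0 < b2 & 0 < b3] by split; lra.
exists A; split.
- move=> [x y] [/= xr]; rewrite ler_norml => /andP[y1 y2]; split=> //=.
  have := phiB x xr; have := phiB (- x); rewrite normrN => /(_ xr).
  by have [y0|y0] := leP 0 y; [left|right]; split=> /=; lra.
- exists (r + 2 * F + 1) => -[x y] [/= xr Axy]; split=> /=; first by lra.
  have := phiB x xr; have := phiB (- x); rewrite normrN => /(_ xr).
  by rewrite ler_norml; case: Axy => -[/=]; lra.
- move=> [x y] [/= xr [xy_up|xy_up]].
    have [d [[-> | ->] dA]] := steer x y xr xy_up.
      exact: in_hutchinson_Sp (dA _ b3c).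
    by apply: in_hutchinson_Sm => //; have := dA _ b2c; rewrite !opprK.
  have [|d [[-> | ->] dA]] := steer (- x) (- y) _ xy_up; first by rewrite normrN.
    apply: in_hutchinson_Sm => //; have := AN _ _ (dA _ b2c).
    by rewrite !opprB !mulrN !opprK ![1 + _]addrC.
  apply: in_hutchinson_Sp => //; have := AN _ _ (dA _ b3c).
  by rewrite !mulrN !opprD !opprK.
Qed.

(** A point of [A] is the image of a point of [A] under arbitrarily long compositions
    of the contractions.  The same composition sends a point of [L] to a point of [L]
    nearby, and [L] is closed. *)
Lemma backward_invariant_sub_attractor (R : realType) (b1 b2 b3 M : R)
    (A L : set (R * R)) : 1 < b1 -> 1 < b2 -> 1 < b3 ->
  is_attractor b1 b2 b3 L -> A `<=` box M M -> A `<=` hutchinson b1 b2 b3 A ->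
  A `<=` L.
Proof.
move=> b1_gt1 b2_gt1 b3_gt1 [[l0 Ll0] Lc LE] AM AH.
have Lclosed : closed L by apply: compact_closed => //; exact: norm_hausdorff.
pose rho := (Num.min b1 (Num.min b2 b3))^-1.
have rho_inv b : Num.min b1 (Num.min b2 b3) <= b -> b^-1 <= rho.
  by move=> bm; rewrite lef_pV2// posrE ?(lt_le_trans _ bm)// !lt_min; lra.
have [r1 r2 r3] : [/\ b1^-1 <= rho, b2^-1 <= rho & b3^-1 <= rho].
  by split; apply: rho_inv; rewrite !ge_min !lexx ?orbT.
have rho0 : 0 < rho by apply: lt_le_trans r1; rewrite invr_gt0; lra.
have rho1 : rho < 1 by rewrite invf_lt1 ?lt_min; lra.
pose D := M + `|l0.1| + `|l0.2|.
have approx n p : A p -> exists2 l, L l &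
    `|p.1 - l.1| <= D * rho ^+ n /\ `|p.2 - l.2| <= D * rho ^+ n.
  elim: n p => [|n IH] p Ap.
    exists l0 => //; have [p1 p2] := AM _ Ap; rewrite expr0 mulr1 /D.
    have := ler_normB p.1 l0.1; have := ler_normB p.2 l0.2.
    by have := normr_ge0 l0.1; have := normr_ge0 l0.2; split; lra.
  have contract u v b : 1 < b -> b^-1 <= rho -> `|u| <= D * rho ^+ n ->
      v = u / b -> `|v| <= D * rho ^+ n.+1.
    move=> b1' br un ->; rewrite normrM exprSr mulrA ler_pM//.
    by rewrite gtr0_norm// invr_gt0; lra.
  have [] := AH _ Ap => -[q Aq <-]; have [l Ll [l1 l2]] := IH _ Aq.
    exists (Sm b1 b2 l); first by rewrite LE; left; exists l.
    by split; [apply: contract r1 l1 _|apply: contract r2 l2 _] => //=;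
      rewrite -mulrBl; congr (_ / _); ring.
  exists (Sp b1 b3 l); first by rewrite LE; right; exists l.
  by split; [apply: contract r1 l1 _|apply: contract r3 l2 _] => //=;
    rewrite -mulrBl; congr (_ / _); ring.
move=> p Ap; apply: Lclosed => U /nbhs_ballP[e /= e0 peU].
have : (fun n => D * rho ^+ n) @ \oo --> (0 : R).
  rewrite -[0 in X in _ --> X](mulr0 D); apply: cvgM; first exact: cvg_cst.
  by apply: cvg_expr; rewrite gtr0_norm.
move/cvgrPdist_lt => /(_ e e0) [n _ /(_ n (leqnn n))] /=.
rewrite sub0r normrN => /(le_lt_trans (ler_norm _)) Dn.
have [l Ll [l1 l2]] := approx n p Ap; exists l; split=> //; apply: peU.
by split; rewrite /= -ball_normE /=; apply: le_lt_trans Dn.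
Qed.

(** * Existence of the attractor *)

Lemma affine_pair_continuous (R : realType) (b b' v v' : R) :
  continuous (fun p : R * R => ((p.1 + v) / b, (p.2 + v') / b')).
Proof.
move=> p.
have h1 : (q.1 + v) / b @[q --> p] --> (p.1 + v) / b.
  by apply: cvgM; [apply: cvgD; [exact: cvg_fst|exact: cvg_cst]|exact: cvg_cst].
have h2 : (q.2 + v') / b' @[q --> p] --> (p.2 + v') / b'.
  by apply: cvgM; [apply: cvgD; [exact: cvg_snd|exact: cvg_cst]|exact: cvg_cst].
exact: cvg_pair h1 h2.
Qed.

Lemma compact_hutchinson (R : realType) (b1 b2 b3 : R) A :
  compact A -> compact (hutchinson b1 b2 b3 A).
Proof.
move=> cA; apply: compactU; apply: continuous_compact => //;
  apply: continuous_subspaceT; exact: affine_pair_continuous.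
Qed.

Lemma compact_box (R : realType) (r s : R) : compact (box r s).
Proof.
have -> : box r s = `[- r, r] `*` `[- s, s].
  apply/seteqP; split=> -[x y]; rewrite /box /= !in_itv /= !ler_norml;
    by case=> -> ->.
by apply: compact_setX; exact: segment_compact.
Qed.

(** If the preimage under [Sm] leaves some [K m], then from [m] on the point is in the
    image of [K n] under [Sp], and by monotonicity this holds for all [n].  As the maps
    are injective, one preimage serves for all [n]. *)
Lemma hutchinson_bigcap (R : realType) (b1 b2 b3 : R) (K : nat -> set (R * R)) :
  b1 != 0 -> b2 != 0 -> b3 != 0 -> (forall n, K n.+1 `<=` K n) ->
  \bigcap_n hutchinson b1 b2 b3 (K n) `<=` hutchinson b1 b2 b3 (\bigcap_n K n).
Proof.
move=> b10 b20 b30 KS.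
have Kmono m n : (m <= n)%N -> K n `<=` K m.
  by move=> /subnK <-; elim: (n - m)%N => // k IH; exact: subset_trans (KS _) IH.
move=> [x y] Hxy.
have [mx|] := pselect (forall n, K n (b1 * x + 1, b2 * y + 1)).
  left; exists (b1 * x + 1, b2 * y + 1) => [n _|]; first exact: mx.
  by rewrite /Sm /= !addrK !(mulrC _ x) !(mulrC _ y) !mulfK.
move=> /existsNP[m nKm]; right; exists (b1 * x - 1, b3 * y - 1); last first.
  by rewrite /Sp /= !subrK !(mulrC _ x) !(mulrC _ y) !mulfK.
move=> n _; have [] := Hxy (maxn m n) I => -[[u v] Kuv []].
  move=> ux vy; case: nKm; apply: (Kmono _ _ (leq_maxl m n)).
  by rewrite -ux -vy !(mulrC _ (_ / _)) !divfK// !subrK.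
move=> ux vy; apply: (Kmono _ _ (leq_maxr m n)).
by rewrite -ux -vy !(mulrC _ (_ / _)) !divfK// !addrK.
Qed.

(** The attractor is the intersection of the iterated images of a box mapped into
    itself.  The fixed point of [Sm] shows that it is not empty. *)
Lemma attractorP (R : realType) (b1 b2 b3 : R) : 1 < b1 -> 1 < b2 -> 1 < b3 ->
  is_attractor b1 b2 b3 (attractor b1 b2 b3).
Proof.
move=> b1_gt1 b2_gt1 b3_gt1; apply: xgetPex.
pose H := hutchinson b1 b2 b3.
pose M := Num.max (b1 - 1)^-1 (Num.max (b2 - 1)^-1 (b3 - 1)^-1).
have geM (b : R) : 1 < b -> (b - 1)^-1 <= M -> 1 <= (b - 1) * M.
  move=> b_gt1 /(ler_wpM2l (_ : 0 <= b - 1)).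
  by rewrite divff ?gt_eqF//; [apply|]; lra.
have [M1 M2 M3] : [/\ 1 <= (b1 - 1) * M, 1 <= (b2 - 1) * M & 1 <= (b3 - 1) * M].
  by split; apply: geM; rewrite // !le_max !lexx ?orbT.
have shrink (u v b : R) : 1 < b -> 1 <= (b - 1) * M -> `|u| <= M -> `|v| <= 1 ->
    `|(u + v) / b| <= M.
  move=> b_gt1 bM uM v1; have b0 : 0 < b by lra.
  rewrite normrM (gtr0_norm (_ : 0 < b^-1)) ?invr_gt0// ler_pdivrMr//.
  by have := ler_normD u v; lra.
pose K n := iter n H (box M M).
have KS n : K n.+1 `<=` K n.
  elim: n => [|n IH]; last exact: hutchinsonS.
  by move=> p [] [q [q1 q2] <-]; split; apply: shrink; rewrite ?normrN ?normr1.
have Kc n : compact (K n).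
  by elim: n => [|n IH]; [exact: compact_box|exact: compact_hutchinson].
have Kclosed n : closed (K n) by apply: compact_closed => //; exact: norm_hausdorff.
exists (\bigcap_n K n); split.
- pose p := (- (b1 - 1)^-1, - (b2 - 1)^-1); exists p => n _.
  have pS : Sm b1 b2 p = p.
    by rewrite /Sm /p /=; congr pair; field; apply/andP; split; lra.
  elim: n => [|n IH]; last by left; exists p.
  have ge0 (b : R) : 1 < b -> 0 <= (b - 1)^-1 by move=> b_gt1; rewrite invr_ge0; lra.
  by split; rewrite /= normrN ger0_norm ?ge0// !le_max lexx ?orbT.
- apply: (subclosed_compact _ (Kc 0%N)); last by move=> p; exact.
  exact: closed_bigI.
- apply/seteqP; split => [p Kp|p Hp n _].
    by apply: hutchinson_bigcap KS _ _ => [|||n _]; [lra|lra|lra|exact: (Kp n.+1)].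
  by apply: (KS n); apply: hutchinsonS Hp => q; exact.
Qed.

(** * Fibres and interior *)

(** With [e = 1/(b1-1)] the end of the projection, the expanding move towards 0
    multiplies the distance [e - |x|] by [b1], unless it crosses 0, in which case it lands
    in [[-1, 1]].  So every interior [x] reaches [[-r, r]] after finitely many moves. *)
Lemma fibre_segment_spread (R : realType) (b1 b2 b3 r : R) (L : set (R * R)) :
  1 < b1 -> 0 < b2 -> 0 < b3 -> 1 <= r -> (b1 - 1) * r < 1 ->
  hutchinson b1 b2 b3 L `<=` L ->
  (forall x, `|x| <= r -> exists a b, a < b /\ forall y, a <= y <= b -> L (x, y)) ->
  forall x, `|x| < (b1 - 1)^-1 ->
    exists a b, a < b /\ forall y, a <= y <= b -> L (x, y).
Proof.
move=> b1_gt1 b20 b30 r1 b1r HL core.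
pose e := (b1 - 1)^-1.
have eE : (b1 - 1) * e = 1 by rewrite divff// gt_eqF//; lra.
have re : r < e by rewrite -(ltr_pM2l (_ : 0 < b1 - 1)); lra.
have b10 : 0 < b1 by lra.
suff spread n x : e - r <= b1 ^+ n * (e - `|x|) ->
    exists a b, a < b /\ forall y, a <= y <= b -> L (x, y).
  move=> x xe.
  have : (fun n => b1^-1 ^+ n) @ \oo --> (0 : R).
    by apply: cvg_expr; rewrite gtr0_norm ?invr_gt0// invf_lt1.
  have d0 : 0 < (e - `|x|) / (e - r) by rewrite divr_gt0 ?subr_gt0.
  move/cvgrPdist_lt => /(_ _ d0) [n _ /(_ n (leqnn n))] /=.
  rewrite sub0r normrN exprVn gtr0_norm ?invr_gt0 ?exprn_gt0// => h.
  apply: (spread n); move: h; rewrite ltr_pdivlMr ?subr_gt0//.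
  by rewrite mulrC ltr_pdivrMr ?exprn_gt0// mulrC => /ltW.
elim: n x => [|n IH] x.
  by rewrite expr0 mul1r => h; apply: core; lra.
have [xr|rx] := leP `|x| r; first by move=> _; exact: core.
move=> h.
have closer (z : R) : `|z| <= r \/ e - `|z| = b1 * (e - `|x|) ->
    e - r <= b1 ^+ n * (e - `|z|).
  move=> [zr|->]; last by rewrite mulrA -exprSr.
  have : 1 <= b1 ^+ n by rewrite exprn_ege1// ltW.
  by move=> /(ler_wpM2r (_ : 0 <= e - `|z|)); rewrite mul1r; lra.
have shift (b y a a' v : R) : 0 < b -> (a + v) / b <= y <= (a' + v) / b ->
    a <= b * y - v <= a'.
  move=> b0; rewrite ler_pdivrMr// ler_pdivlMr// mulrC => /andP[? ?].
  by apply/andP; split; lra.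
have lt_shift (b a a' v : R) : 0 < b -> a < a' -> (a + v) / b < (a' + v) / b.
  by move=> b0 aa'; rewrite ltr_pM2r ?invr_gt0// ltrD2r.
have [x0|x0] := leP 0 x.
  have [|a [a' [aa' La]]] := IH (b1 * x - 1).
    apply: closer; have [x'0|x'0] := leP 0 (b1 * x - 1).
      by right; rewrite !ger0_norm//; lra.
    left; rewrite ltr0_norm//; have : 0 <= b1 * x by rewrite mulr_ge0// ltW.
    lra.
  exists ((a + 1) / b3), ((a' + 1) / b3); split; first exact: lt_shift.
  by move=> y /shift -/(_ b30) ya; apply: HL; apply: in_hutchinson_Sp => //; exact: La.
have [|a [a' [aa' La]]] := IH (b1 * x + 1).
  apply: closer; have [x'0|x'0] := leP (b1 * x + 1) 0.
    by right; rewrite (ler0_norm x'0) (ltr0_norm x0); lra.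
  left; rewrite gtr0_norm//; have : 0 < b1 * - x by rewrite mulr_gt0//; lra.
  lra.
exists ((a - 1) / b2), ((a' - 1) / b2); split; first exact: lt_shift.
move=> y /shift -/(_ b20); rewrite opprK => ya.
by apply: HL; apply: in_hutchinson_Sm => //; exact: La.
Qed.

Theorem theorem2p8 (R : realType) (b1 : R)
    (hb1 : 1 < b1 < (1 + Num.sqrt 5) / 2) :
  exists c : R, 0 < c /\
    forall b2 b3 : R, 1 < b2 < 1 + c -> 1 < b3 < 1 + c ->
      (forall x : R, - (1 / (b1 - 1)) < x < 1 / (b1 - 1) ->
         exists I : set R,
           nondegenerate_interval I /\ I `<=` fibre b1 b2 b3 x) /\
      (attractor b1 b2 b3)° !=set0 /\
      (attractor b1 b2 b3)° (0, 0).
Proof.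
have /andP[b1_gt1 b1_gold] := hb1.
have [r [c [r1 b1r c0 inv]]] := box_in_backward_invariant _ _ b1_gt1
  (golden_ratio_bound _ _ b1_gt1 b1_gold).
exists c; split=> // b2 b3 b2c b3c.
have [b2_gt1 b3_gt1] : 1 < b2 /\ 1 < b3 by split; lra.
have [A [boxA [M AM] AH]] := inv b2 b3 b2c b3c.
have attr := attractorP _ _ _ _ b1_gt1 b2_gt1 b3_gt1.
have boxL : box r 1 `<=` attractor b1 b2 b3.
  apply: subset_trans boxA _.
  exact: backward_invariant_sub_attractor b1_gt1 b2_gt1 b3_gt1 attr AM AH.
have int0 : (attractor b1 b2 b3)° (0, 0).
  apply/nbhs_ballP; exists 1 => //= -[x y] [] /=.
  rewrite -!ball_normE /= !sub0r !normrN => x1 y1.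
  by apply: boxL; split=> /=; lra.
split; last by split=> //; exists (0, 0).
move=> x xe; have [|||||a [b [ab fib]]] :=
    fibre_segment_spread _ b1 b2 b3 r (attractor b1 b2 b3) b1_gt1 _ _ r1 b1r _ _ x.
- lra.
- lra.
- by case: attr => _ _ {2}->.
- move=> z zr; exists (- 1), 1; split; first lra.
  by move=> y y1; apply: boxL; split=> //=; rewrite ler_norml.
- by rewrite ltr_norml -div1r.
exists [set` `[a, b]]; split; first split.
- exact: interval_is_interval.
- by exists a, b; rewrite /= !in_itv /= !lexx ltW.
- by move=> y /= yab; apply/xsectionP; apply: fib; rewrite in_itv in yab.
Qed.
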